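(* Let $(M,g)$ be a general relativistic perfect fluid spacetime with isotropic pressure $p$, energy-density $\sigma$, cosmological constant $\lambda$, gravitational constant $k$ and velocity vector field $\xi$ with $g$-dual $1$-form $\eta$, and let $(g,\xi,a,b)$ be an $\eta$-Einstein soliton in $M$, i.e. $a,b$ are real constants with $\mathcal{L}_{\xi}g+2S+(2a-r) g+2b\,\eta\otimes \eta=0$. Then $$a=\lambda-kp-\frac{\mathrm{div}(\xi)}{3},\qquad b=-k(\sigma+p)-\frac{\mathrm{div}(\xi)}{3}.$$
   Context: A perfect fluid spacetime here is a $4$-dimensional smooth manifold $M$ with a Lorentzian metric $g$ (one negative sign in the signature), a smooth velocity vector field $\xi$ with $g(\xi,\xi)=-1$ and dual $1$-form $\eta(X)=g(X,\xi)$, and smooth functions $p$ (pressure) and $\sigma$ (energy-density), such that Einstein's equations $kT=S+(\lambda-\frac r2)g$ hold with $T=pg+(\sigma+p)\eta\otimes\eta$; equivalently $$S(X,Y)=\left(\lambda+\frac{k(\sigma-p)}{2}\right)g(X,Y)+k(\sigma+p)\eta(X)\eta(Y)$$ for all vector fields $X,Y$. Here $S$ is the Ricci tensor, $r$ the scalar curvature, $\lambda$ a real constant and $k$ the gravitational constant. $\mathcal{L}_\xi g$ is the Lie derivative, $\mathrm{div}(\xi)$ the trace of $X\mapsto\nabla_X\xi$. *)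

(* Defs.v *)
From mathcomp Require Import all_boot all_order all_algebra.
From mathcomp Require Import all_classical all_reals all_analysis.
Import Order.TTheory GRing.Theory Num.Theory numFieldNormedType.Exports.

Set Implicit Arguments.
Unset Strict Implicit.
Unset Printing Implicit Defensive.

Local Open Scope classical_set_scope.
Local Open Scope ring_scope.

(* [coord] and [param] are total functions; only their restrictions to [dom]
   and to the open set [coord @` dom], which are inverse homeomorphisms, are
   meaningful. *)
Record chart (R : realType) (M : topologicalType) := Chart {
  dom : set M;
  coord : M -> 'rV[R]_4;
  param : 'rV[R]_4 -> M;
  open_dom : open dom;
  open_codom : open (coord @` dom);
  coordK : forall m, dom m -> param (coord m) = m;
  coord_continuous : forall m, dom m -> {for m, continuous coord};
  param_continuous : forall m, dom m -> {for coord m, continuous param}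
}.

Section LocalCalculus.
Context {R : realType} {M : topologicalType}.
Implicit Types (c : chart R M) (f : M -> R).

(* The function (d f / d x^i), where x^0, ..., x^3 are the coordinates of c. *)
Definition partial c (i : 'I_4) f (m : M) : R :=
  'D_(delta_mx 0 i) (f \o param c) (coord c m).

(* Continuity and existence of all iterated partial derivatives at every point
   of U; to be used with U an open subset of [dom c]. *)
Definition smooth_on c (U : set M) f : Prop :=
  forall (s : seq 'I_4) (m : M), U m ->
    {for m, continuous (foldr (partial c) f s)} /\
    forall i : 'I_4,
      derivable (foldr (partial c) f s \o param c) (coord c m) (delta_mx 0 i).

(* The Jacobian matrix (d y^i / d x^j) of the coordinates y of c' with respect
   to the coordinates x of c. *)
Definition jacobian c c' (m : M) : 'M[R]_4 :=
  \matrix_(i, j) partial c j (fun q => coord c' q 0 i) m.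

End LocalCalculus.

Record manifold4 (R : realType) := Manifold4 {
  points :> topologicalType;
  manifold_hausdorff : hausdorff_space points;
  manifold_second_countable : @second_countable points;
  atlas : set (chart R points);
  atlas_cover : forall m : points, exists2 c, atlas c & dom c m;
  atlas_smooth : forall c c', atlas c -> atlas c' -> forall i : 'I_4,
    smooth_on c (dom c `&` dom c') (fun m => coord c' m 0 i)
}.

Definition smooth (R : realType) (M : manifold4 R) (f : M -> R) : Prop :=
  forall c, atlas c -> smooth_on c (dom c) f.

(* A tensor field is given by its components in every chart of the atlas,
   subject to the usual transformation law; [X c m] is the column of the
   components X^i at m, meaningful for m in [dom c]. *)
Record vector_field (R : realType) (M : manifold4 R) := VectorField {
  vcomp :> chart R M -> M -> 'cV[R]_4;
  vcomp_smooth : forall c, atlas c -> forall i : 'I_4,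
    smooth_on c (dom c) (fun m => vcomp c m i 0);
  vcomp_transform : forall c c' m, atlas c -> atlas c' -> dom c m -> dom c' m ->
    vcomp c' m = jacobian c c' m *m vcomp c m
}.

Definition minkowski (R : realType) : 'M[R]_4 :=
  diag_mx (\row_(i < 4) if i == ord0 then -1 else 1).

(* [g c m] is the matrix (g_ij) at m.  By [gcomp_signature] it has signature
   (-,+,+,+). *)
Record lorentz_metric (R : realType) (M : manifold4 R) := LorentzMetric {
  gcomp :> chart R M -> M -> 'M[R]_4;
  gcomp_smooth : forall c, atlas c -> forall i j : 'I_4,
    smooth_on c (dom c) (fun m => gcomp c m i j);
  gcomp_transform : forall c c' m, atlas c -> atlas c' -> dom c m -> dom c' m ->
    gcomp c m = (jacobian c c' m)^T *m gcomp c' m *m jacobian c c' m;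
  gcomp_sym : forall c m, atlas c -> dom c m -> (gcomp c m)^T = gcomp c m;
  gcomp_signature : forall c m, atlas c -> dom c m ->
    exists2 P : 'M[R]_4, P \in unitmx & P^T *m gcomp c m *m P = minkowski R
}.

(* In this section c is a fixed chart, and a vector field on [dom c] is a
   function X : M -> 'cV_4 giving its components in the coordinates of c. *)
Section InChart.
Context {R : realType} {M : manifold4 R}.
Variables (g : lorentz_metric M) (c : chart R M).
Implicit Types (X Y Z : M -> 'cV[R]_4) (f : M -> R).

Definition coord_field (i : 'I_4) : M -> 'cV[R]_4 := fun=> delta_mx i 0.

Definition inner X Y (m : M) : R :=
  \sum_(i < 4) \sum_(j < 4) g c m i j * X m i 0 * Y m j 0.

Definition dir X f (m : M) : R := \sum_(i < 4) X m i 0 * partial c i f m.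

Definition bracket X Y (m : M) : 'cV[R]_4 :=
  \col_i (dir X (fun q => Y q i 0) m - dir Y (fun q => X q i 0) m).

(* The Christoffel symbol Gamma^i_jk of the Levi-Civita connection. *)
Definition christoffel (i j k : 'I_4) (m : M) : R :=
  2^-1 * \sum_(l < 4) invmx (g c m) i l *
    (partial c j (fun q => g c q l k) m + partial c k (fun q => g c q l j) m
     - partial c l (fun q => g c q j k) m).

Definition nabla X Y (m : M) : 'cV[R]_4 :=
  \col_i (dir X (fun q => Y q i 0) m
    + \sum_(j < 4) \sum_(k < 4) christoffel i j k m * X m j 0 * Y m k 0).

Definition riemann X Y Z (m : M) : 'cV[R]_4 :=
  nabla X (nabla Y Z) m - nabla Y (nabla X Z) m - nabla (bracket X Y) Z m.

(* S(Y, Z) is the trace of X |-> R(X, Y) Z. *)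
Definition ricci (m : M) : 'M[R]_4 :=
  \matrix_(j, k) \sum_(i < 4)
    riemann (coord_field i) (coord_field j) (coord_field k) m i 0.

Definition scalar_curvature (m : M) : R := \tr (invmx (g c m) *m ricci m).

(* The trace of X |-> nabla_X xi *)
Definition divergence X (m : M) : R :=
  \sum_(i < 4) nabla (coord_field i) X m i 0.

(* (L_xi g)(Y, Z) = xi (g(Y, Z)) - g([xi, Y], Z) - g(Y, [xi, Z]) *)
Definition lie_metric X (m : M) : 'M[R]_4 :=
  \matrix_(i, j) (dir X (inner (coord_field i) (coord_field j)) m
    - inner (bracket X (coord_field i)) (coord_field j) m
    - inner (coord_field i) (bracket X (coord_field j)) m).

(* The components eta_i of the 1-form g(-, X), and of its tensor square *)
Definition dual_form X (m : M) : 'cV[R]_4 := \col_i inner (coord_field i) X m.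

Definition dual_form_sq X (m : M) : 'M[R]_4 :=
  dual_form X m *m (dual_form X m)^T.

End InChart.

Section PerfectFluid.
Context {R : realType} {M : manifold4 R}.
Variables (g : lorentz_metric M) (xi : vector_field M).

Definition energy_momentum (p sigma : M -> R) (c : chart R M) (m : M) :
    'M[R]_4 :=
  p m *: g c m + (sigma m + p m) *: dual_form_sq g c (xi c) m.

Record perfect_fluid (p sigma : M -> R) (lambda k : R) : Prop := PerfectFluid {
  pressure_smooth : smooth p;
  energy_smooth : smooth sigma;
  velocity_unit : forall c m, atlas c -> dom c m ->
    inner g c (xi c) (xi c) m = -1;
  einstein_equations : forall c m, atlas c -> dom c m ->
    k *: energy_momentum p sigma c m =
      ricci g c m + (lambda - scalar_curvature g c m / 2) *: g c m
}.

Definition eta_einstein_soliton (a b : R) : Prop :=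
  forall c m, atlas c -> dom c m ->
    lie_metric g c (xi c) m + 2 *: ricci g c m
    + (2 * a - scalar_curvature g c m) *: g c m
    + (2 * b) *: dual_form_sq g c (xi c) m = 0.

End PerfectFluid.

(* Main.v *)
Require Import Defs.
From mathcomp Require Import all_boot all_order all_algebra.
From mathcomp Require Import all_classical all_reals all_analysis.
From mathcomp Require Import ring lra.
Import Order.TTheory GRing.Theory Num.Theory numFieldNormedType.Exports.

(* Eliminating the Ricci tensor between Einstein's equations and the soliton
   equation leaves L_xi g = - 2 A g - 2 B eta (x) eta with A = a + k p - lambda
   and B = b + k (sigma + p).  Evaluating at (xi, xi) gives A = B, because
   (L_xi g)(xi, xi) = xi (g(xi, xi)) = 0; taking the g-trace gives
   2 div xi = - 8 A + 2 B. *)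

Set Implicit Arguments.
Unset Strict Implicit.
Unset Printing Implicit Defensive.

Local Open Scope classical_set_scope.
Local Open Scope ring_scope.

Section Partial.
Context {R : realType} {M : topologicalType}.
Variables (c : chart R M) (m : M).
Implicit Types (f h : M -> R).

Lemma partial_cst (i : 'I_4) (a : R) : partial c i (fun=> a) m = 0.
Proof. exact: derive_cst. Qed.

(** The coordinate image of [dom c] is an open neighbourhood of the point, and a derivative sees
    only nearby values. This serves identities known only on [dom c], such as the normalisation of
    the velocity field. *)
Lemma eq_in_dom_partial (i : 'I_4) f h : dom c m ->
  {in dom c, f =1 h} -> partial c i f m = partial c i h m.
Proof.
move=> cm fh; apply: near_eq_derive.
have : nbhs (Defs.coord c m) (Defs.coord c @` dom c).
  by apply: open_nbhs_nbhs; split; [exact: open_codom | exists m].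
by apply: filterS => _ [q cq <-] /=; rewrite coordK// fh// inE.
Qed.

Lemma smooth_on_derivable (U : set M) f (i : 'I_4) : smooth_on c U f -> U m ->
  derivable (f \o param c) (Defs.coord c m) (delta_mx 0 i).
Proof. by move=> sf Um; have [_] := sf [::] m Um; apply. Qed.

End Partial.

Section InChart.
Context {R : realType} {M : manifold4 R}.
Variables (g : lorentz_metric M) (c : chart R M).
Implicit Types (X Y : M -> 'cV[R]_4).

Definition partial_metric (l : 'I_4) (m : M) : 'M[R]_4 :=
  \matrix_(i, j) partial c l (fun q => g c q i j) m.

(** Columns carry the direction of differentiation, so multiplying by a column [v] differentiates
    the components of [X] along [v]. *)
Definition partial_field X (m : M) : 'M[R]_4 :=
  \matrix_(i, l) partial c l (fun q => X q i 0) m.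

Lemma sum_coord_field (F : 'I_4 -> R) (i : 'I_4) (m : M) :
  \sum_j F j * @coord_field R M i m j 0 = F i.
Proof.
rewrite (bigD1 i)//= !mxE !eqxx mulr1 big1 ?addr0// => j ji.
by rewrite !mxE (negPf ji) mulr0.
Qed.

Lemma innerE X Y (m : M) : inner g c X Y m = ((X m)^T *m g c m *m Y m) 0 0.
Proof.
rewrite mxE /inner exchange_big; apply: eq_bigr => j _.
rewrite mxE mulr_suml; apply: eq_bigr => i _.
by rewrite !mxE; ring.
Qed.

Lemma inner_coord_fieldr X (j : 'I_4) (m : M) :
  inner g c X (coord_field j) m = \sum_i X m i 0 * g c m i j.
Proof.
rewrite /inner; apply: eq_bigr => i _.
by rewrite sum_coord_field mulrC.
Qed.

Lemma inner_coord_fieldl Y (i : 'I_4) (m : M) :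
  inner g c (coord_field i) Y m = \sum_j g c m i j * Y m j 0.
Proof.
rewrite /inner exchange_big; apply: eq_bigr => j _.
under eq_bigr => l _ do rewrite mulrAC.
by rewrite sum_coord_field.
Qed.

Lemma dual_formE X (m : M) : dual_form g c X m = g c m *m X m.
Proof. by apply/colP => i; rewrite !mxE inner_coord_fieldl. Qed.

Lemma dir_coord_field (i : 'I_4) (f : M -> R) (m : M) :
  dir c (coord_field i) f m = partial c i f m.
Proof.
rewrite /dir; under eq_bigr => l _ do rewrite mulrC.
by rewrite sum_coord_field.
Qed.

Lemma bracket_coord_fieldE X (j i : 'I_4) (m : M) :
  bracket c X (coord_field j) m i 0 = - partial_field X m i j.
Proof.
rewrite !mxE dir_coord_field /dir big1 ?sub0r ?mxE// => l _.
by rewrite partial_cst mulr0.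
Qed.

(** This is X^l d_l g_ij + (d_i X^l) g_lj + g_il d_j X^l; the minus signs of the definition cancel
    against [X, d_j] = - d_j X. *)
Lemma lie_metricE X (m : M) : lie_metric g c X m =
  \sum_l X m l 0 *: partial_metric l m
  + (partial_field X m)^T *m g c m + g c m *m partial_field X m.
Proof.
apply/matrixP => i j; rewrite !mxE summxE.
have -> : inner g c (coord_field i) (coord_field j) = fun q => g c q i j.
  by apply/funext => q; rewrite inner_coord_fieldl sum_coord_field.
rewrite inner_coord_fieldr inner_coord_fieldl -!sumrN.
congr (_ + _ + _); apply: eq_bigr => l _; rewrite ?bracket_coord_fieldE !mxE//.
  by rewrite mulNr opprK.
by rewrite mulrN opprK.
Qed.

(** The Leibniz rule for g_ij X^i Y^j, one term for each differentiated factor. *)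
Lemma partial_inner X Y (l : 'I_4) (m : M) : atlas c ->
  (forall i, smooth_on c (dom c) (fun q => X q i 0)) ->
  (forall i, smooth_on c (dom c) (fun q => Y q i 0)) -> dom c m ->
  partial c l (inner g c X Y) m =
    ((X m)^T *m partial_metric l m *m Y m) 0 0
    + ((col l (partial_field X m))^T *m g c m *m Y m) 0 0
    + ((X m)^T *m g c m *m col l (partial_field Y m)) 0 0.
Proof.
move=> ca sX sY cm; rewrite /partial.
pose G i j := (fun q => g c q i j) \o param c.
pose U i := (fun q => X q i 0) \o param c.
pose V i := (fun q => Y q i 0) \o param c.
(* The sum over [j] is taken outermost because the matrix product (X^T g) Y unfolds in that
   order. *)
have -> : inner g c X Y \o param c = \sum_j \sum_i G i j * U i * V j.
  apply/funext => q; rewrite /= /inner exchange_big fct_sumE.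
  by apply: eq_bigr => j _; rewrite fct_sumE; apply: eq_bigr.
have dV j : is_derive (Defs.coord c m) (delta_mx 0 l) (V j)
    (partial c l (fun q => Y q j 0) m).
  exact: derivableP (smooth_on_derivable (sY j) cm).
have dU i : is_derive (Defs.coord c m) (delta_mx 0 l) (U i)
    (partial c l (fun q => X q i 0) m).
  exact: derivableP (smooth_on_derivable (sX i) cm).
have dG i j : is_derive (Defs.coord c m) (delta_mx 0 l) (G i j)
    (partial c l (fun q => g c q i j) m).
  exact: derivableP (smooth_on_derivable (gcomp_smooth g ca i j) cm).
have dGUV i j := is_deriveM (is_deriveM (dG i j) (dU i)) (dV j).
have dsum := is_derive_sum (fun j => is_derive_sum (dGUV^~ j)).
rewrite (@derive_val _ _ _ _ _ _ _ dsum).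
rewrite !mxE -!big_split; apply: eq_bigr => j _ /=.
rewrite !mxE !mulr_suml -!big_split; apply: eq_bigr => i _ /=.
have -> : (G i j * U i) (Defs.coord c m) = g c m i j * X m i 0.
  by rewrite -[in RHS](coordK cm).
rewrite /G /U /V /= coordK// !mxE.
by rewrite /GRing.scale /=; ring.
Qed.

Lemma partial_field_mul X (v : 'cV[R]_4) (m : M) :
  partial_field X m *m v = \sum_l v l 0 *: col l (partial_field X m).
Proof.
apply/colP => i; rewrite mxE summxE; apply: eq_bigr => l _.
by rewrite !mxE mulrC.
Qed.

(** Invariantly, X(g(X,X)) = (L_X g)(X,X) because [X,X] = 0. Here the three Leibniz terms,
    contracted with X^l, match the three terms of [lie_metricE] one by one. *)
Lemma dir_inner X (m : M) : atlas c ->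
  (forall i, smooth_on c (dom c) (fun q => X q i 0)) -> dom c m ->
  dir c X (inner g c X X) m = ((X m)^T *m lie_metric g c X m *m X m) 0 0.
Proof.
move=> ca sX cm; rewrite lie_metricE !mulmxDr !mulmxDl /dir.
under eq_bigr => l _ do rewrite partial_inner// !mulrDr.
rewrite !big_split /= [RHS]mxE [X in _ = X + _]mxE; congr (_ + _ + _).
- rewrite mulmx_sumr mulmx_suml summxE; apply: eq_bigr => l _.
  by rewrite -scalemxAr -scalemxAl [RHS]mxE.
- rewrite mulmxA -trmx_mul partial_field_mul.
  rewrite raddf_sum !mulmx_suml summxE; apply: eq_bigr => l _.
  by rewrite /= linearZ /= -!scalemxAl [RHS]mxE.
- rewrite mulmxA -[X in _ = fun_of_matrix X _ _]mulmxA partial_field_mul.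
  rewrite mulmx_sumr summxE; apply: eq_bigr => l _.
  by rewrite -scalemxAr [RHS]mxE.
Qed.

(** The contracted symbol Gamma^i_ik equals half the trace of g^-1 d_k g, the logarithmic derivative
    of sqrt |det g|. *)
Lemma divergenceE X (m : M) : (g c m)^T = g c m ->
  divergence g c X m = \tr (partial_field X m)
    + 2^-1 * \sum_k X m k 0 * \tr (invmx (g c m) *m partial_metric k m).
Proof.
move=> gT; set H := invmx (g c m).
have HT i j : H i j = H j i by rewrite /H -[in LHS]gT -trmx_inv mxE.
have divE i : nabla g c (coord_field i) X m i 0 = partial_field X m i i
    + \sum_k christoffel g c i i k m * X m k 0.
  rewrite !mxE dir_coord_field exchange_big; congr (_ + _).
  apply: eq_bigr => k _; under eq_bigr => j _ do rewrite mulrAC.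
  by rewrite sum_coord_field.
rewrite /divergence (eq_bigr _ (fun i _ => divE i)) big_split /=.
congr (_ + _); rewrite exchange_big mulr_sumr; apply: eq_bigr => k _ /=.
rewrite -mulr_suml mulrCA mulrC; congr (_ * _).
rewrite -mulr_sumr; congr (_ * _).
(* Contracting i with j, two of the three terms of Gamma^i_jk cancel because
   H = g^-1 is symmetric. *)
pose A (i l : 'I_4) := H i l * partial c i (fun q => g c q l k) m.
transitivity (\sum_i \sum_l (A i l - A l i)
    + \sum_i \sum_l H i l * partial c k (fun q => g c q l i) m).
  rewrite -big_split; apply: eq_bigr => i _.
  rewrite -big_split; apply: eq_bigr => l _ /=.
  by rewrite /A [H l i]HT; ring.
have -> : \sum_i \sum_l (A i l - A l i) = 0.
  under eq_bigr => i _ do rewrite sumrB.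
  by rewrite sumrB [X in _ - X]exchange_big subrr.
rewrite add0r; apply: eq_bigr => i _; rewrite mxE.
by apply: eq_bigr => l _; rewrite !mxE.
Qed.

(** By cyclicity and transposition, each of the two terms containing derivatives of [X] has trace
    d_i X^i; the remaining term is twice the Christoffel part of the divergence. *)
Lemma mxtrace_lie_metric X (m : M) : (g c m)^T = g c m -> g c m \in unitmx ->
  \tr (invmx (g c m) *m lie_metric g c X m) = 2 * divergence g c X m.
Proof.
move=> gT gU; rewrite lie_metricE divergenceE// !mulmxDr !mxtraceD.
rewrite mulKmx// [X in _ + X + _]mxtrace_mulC mulmxK// mxtrace_tr.
rewrite mulmx_sumr raddf_sum /=.
under eq_bigr => k _ do rewrite -scalemxAr mxtraceZ.
by field.
Qed.

End InChart.

(** The Minkowski matrix is diagonal with entries 1 and -1, hence invertible, and by the signature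
    condition [g c m] is a factor of it. *)
Lemma gcomp_unitmx (R : realType) (M : manifold4 R) (g : lorentz_metric M)
    (c : chart R M) (m : M) : atlas c -> dom c m -> g c m \in unitmx.
Proof.
move=> ca cm; have [P _ gP] := gcomp_signature g ca cm.
have : Defs.minkowski R \in unitmx.
  rewrite unitmxE det_diag unitfE; apply/prodf_neq0 => i _.
  by rewrite mxE; case: ifP => _; rewrite ?oppr_eq0 oner_eq0.
by rewrite -gP !unitmx_mul => /andP[/andP[]].
Qed.

Theorem mainTheorem7 (R : realType) (M : manifold4 R) (g : lorentz_metric M)
    (xi : vector_field M) (p sigma : M -> R) (lambda k a b : R)
    (hfluid : perfect_fluid g xi p sigma lambda k)
    (hsoliton : eta_einstein_soliton g xi a b) :
  forall (c : chart R M) (m : M), atlas c -> dom c m ->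
    a = lambda - k * p m - divergence g c (xi c) m / 3 /\
    b = - k * (sigma m + p m) - divergence g c (xi c) m / 3.
Proof.
move=> c m ca cm.
set G := g c m; set x := xi c m; set L := lie_metric g c (xi c) m.
have GT : G^T = G := gcomp_sym g ca cm.
have GU : G \in unitmx := gcomp_unitmx g ca cm.
have unit_q : (x^T *m G *m x) 0 0 = -1.
  by rewrite -(innerE g c (xi c) (xi c)) (velocity_unit hfluid ca cm).
pose A := a + k * p m - lambda; pose B := b + k * (sigma m + p m).
(* The soliton equation contains 2 S - r g, and Einstein's equations equate S - (r/2) g with k T -
   lambda g. Hence S and r disappear together, without computing r. *)
have LE : L = - (2 * A) *: G - (2 * B) *: (G *m x *m (x^T *m G)).
  have ein := einstein_equations hfluid ca cm.
  have := hsoliton c m ca cm.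
  have sqE : dual_form_sq g c (xi c) m = G *m x *m (x^T *m G).
    by rewrite /dual_form_sq dual_formE trmx_mul GT.
  move: ein; rewrite /energy_momentum sqE -/L -/G /A /B.
  move=> /matrixP ein /matrixP sol; apply/matrixP => i j.
  move: (ein i j) (sol i j); rewrite !mxE; set z := \sum_(_ < _) _; lra.
(* The function g(xi,xi) is the constant -1 throughout the chart domain, so its derivative along xi
   vanishes. *)
have quad0 : (x^T *m L *m x) 0 0 = 0.
  rewrite -(dir_inner g ca (vcomp_smooth xi ca) cm) /dir big1// => l _.
  rewrite (eq_in_dom_partial l (h := fun=> -1) cm) ?partial_cst ?mulr0//.
  by move=> q; rewrite inE => cq; rewrite (velocity_unit hfluid ca cq).
have AB : A = B.
  move: quad0; rewrite LE.
  have -> : x^T *m (- (2 * A) *: G - (2 * B) *: (G *m x *m (x^T *m G))) *m x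
     = - (2 * A) *: (x^T *m G *m x)
       - (2 * B) *: ((x^T *m G *m x) *m (x^T *m G *m x)).
    by rewrite mulmxBr mulmxBl -!scalemxAr -!scalemxAl !mulmxA.
  (* As a 1 x 1 matrix, x^T G x is the scalar -1 and its square is 1, so the equation reads 2 A - 2
     B = 0. *)
  by rewrite [x^T *m G *m x]mx11_scalar unit_q -scalar_mxM !mxE eqxx !mulr1n; lra.
(* The g-trace of g is the dimension 4, and that of eta (x) eta is g(xi,xi) = -1. *)
have trL : 2 * divergence g c (xi c) m = - (8 * A) + 2 * B.
  rewrite -mxtrace_lie_metric// -/L LE mulmxBr -!scalemxAr mulVmx//.
  rewrite raddfB /= !mxtraceZ mxtrace1 -[G *m x *m _]mulmxA mulKmx//.
  by rewrite mxtrace_mulC trace_mx11 unit_q; lra.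
(* With A = B the trace identity becomes 2 div xi = - 6 A, so A = B = - div xi / 3. *)
by rewrite /A /B in AB trL *; split; lra.
Qed.
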